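(* Let ${\bf\Phi}=(\Phi,\phi,\widetilde\phi):(\mathcal C,p)\to(\mathcal C',p')$ be a universe category functor between universe categories with universes $p:\widetilde U\to U$ and $p':\widetilde U'\to U'$, let $\Gamma\in Ob(CC(\mathcal C,p))$ and $n\ge1$. Then: 1. for $T\in\mathcal{O}b_n(\Gamma)$ one has $$u_{n,H(\Gamma)}(H(T))=\psi(\Gamma)\circ({\bf\Phi}^{n-1}_{int(\Gamma),U}(u_{n,\Gamma}(T))\circ\phi);$$ 2. for $o\in\widetilde{\mathcal{O}b}_n(\Gamma)$ one has $$\widetilde u_{n,H(\Gamma)}(H(o))=\psi(\Gamma)\circ({\bf\Phi}^{n-1}_{int(\Gamma),\widetilde U}(\widetilde u_{n,\Gamma}(o))\circ\widetilde\phi).$$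
   Context: Conventions. Composition is written in diagrammatic order: for $f:X\to Y$, $g:Y\to Z$ the composite is $f\circ g:X\to Z$. $\amalg_{i\in I}A_i$ denotes the set of pairs $(i,a)$, $i\in I$, $a\in A_i$. For a morphism $p:Y\to X$, $sec(p)=\{s:X\to Y\mid s\circ p=Id_X\}$. All constructions below for $(\mathcal C,p)$ are applied also to $(\mathcal C',p')$. Universes. A universe in a category $\mathcal C$ is a morphism $p:\widetilde U\to U$ with a choice, for every $F:X\to U$, of a pullback square with vertex $(X;F)$ and projections $p_F:(X;F)\to X$, $Q(F):(X;F)\to\widetilde U$, $p_F\circ F=Q(F)\circ p$. For $f:X'\to X$ and $F:X\to U$, $Q(f,F):(X';f\circ F)\to(X;F)$ is the unique morphism with $Q(f,F)\circ p_F=p_{f\circ F}\circ f$ and $Q(f,F)\circ Q(F)=Q(f\circ F)$. A universe category $(\mathcal C,p)$ is a category with a universe $p$ and a chosen final object $pt$. Sets $D_p^n(X,Y)$. $D_p^0(X,Y)=Mor_{\mathcal C}(X,Y)$ and $D_p^{n}(X,Y)=\amalg_{F:X\to U}D_p^{n-1}((X;F),Y)$ for $n\ge1$. For $d\in D_p^n(X,Y)$, $f:X'\to X$, $g:Y\to Y'$, elements $f\circ d\in D_p^n(X',Y)$ and $d\circ g\in D_p^n(X,Y')$ are given by composition in $\mathcal C$ for $n=0$ and, for $n\ge1$, by $f\circ(F,a)=(f\circ F,Q(f,F)\circ a)$, $(F,a)\circ g=(F,a\circ g)$. The C-system $CC(\mathcal C,p)$. Define recursively sets $Ob_n(\mathcal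 C,p)$ and functions $int:Ob_n(\mathcal C,p)\to Ob(\mathcal C)$: $Ob_0(\mathcal C,p)=\{tt\}$, $int(tt)=pt$; $Ob_{n+1}(\mathcal C,p)=\amalg_{A\in Ob_n(\mathcal C,p)}Mor_{\mathcal C}(int(A),U)$, $int(A,F)=(int(A);F)$. Objects of $CC(\mathcal C,p)$ are pairs $\Gamma=(n,A)$ with $A\in Ob_n(\mathcal C,p)$, and $int(\Gamma)=int(A)$. Morphisms $\Gamma'\to\Gamma$ are (copies of) the morphisms $int(\Gamma')\to int(\Gamma)$ of $\mathcal C$, so that $int:CC(\mathcal C,p)\to\mathcal C$ is a fully faithful functor. Set $l(n,A)=n$, $ft(n+1,(A,F))=(n,A)$, $ft(0,tt)=(0,tt)$; for $T=(n+1,(A,F))$, $p_T:T\to ft(T)$ is the morphism with $int(p_T)=p_F$. For $n\ge 0$, $\mathcal{O}b_n(\Gamma)=\{T\mid l(T)=l(\Gamma)+n,\ ft^n(T)=\Gamma\}$. For $n\ge1$, $\widetilde{\mathcal{O}b}_n(\Gamma)$ is the set of morphisms $o$ with $\partial(o):=codom(o)\in\mathcal{O}b_n(\Gamma)$ and $o\in sec(p_{\partial(o)})$. Bijections $u_{n,\Gamma}:\mathcal{O}b_n(\Gamma)\to D_p^{n-1}(int(\Gamma),U)$ and $\widetilde u_{n,\Gamma}:\widetilde{\mathcal{O}b}_n(\Gamma)\to D_p^{n-1}(int(\Gamma),\widetilde U)$, $n\ge1$: for $\Gamma=(n,A)$ and $T=(n+1,(A,F))$, $u_{1,\Gamma}(T)=F$;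 $\widetilde u_{1,\Gamma}(o)=int(o)\circ Q(u_{1,\Gamma}(\partial(o)))$; and for $m\ge1$, $u_{m+1,\Gamma}(T)=(u_{1,\Gamma}(ft^m(T)),u_{m,ft^m(T)}(T))$, $\widetilde u_{m+1,\Gamma}(o)=(u_{1,\Gamma}(ft^m(\partial(o))),\widetilde u_{m,ft^m(\partial(o))}(o))$. (Note $int(T)=(int(\Gamma);u_{1,\Gamma}(T))$ for $T\in\mathcal{O}b_1(\Gamma)$.) Universe category functors. A universe category functor ${\bf\Phi}=(\Phi,\phi,\widetilde\phi):(\mathcal C,p)\to(\mathcal C',p')$ consists of a functor $\Phi:\mathcal C\to\mathcal C'$ and morphisms $\phi:\Phi(U)\to U'$, $\widetilde\phi:\Phi(\widetilde U)\to\widetilde U'$ such that $\Phi(pt)$ is final, $\Phi$ takes the chosen pullback squares of the universe $p$ to pullback squares, and the square $\widetilde\phi\circ p'=\Phi(p)\circ\phi$ is a pullback. For $F:X\to U$ let $\iota_{\bf\Phi}^{X,F}:(\Phi(X);\Phi(F)\circ\phi)\to\Phi((X;F))$ be the unique morphism (an isomorphism) with $\iota_{\bf\Phi}^{X,F}\circ\Phi(p_F)=p_{\Phi(F)\circ\phi}$ and $\iota_{\bf\Phi}^{X,F}\circ\Phi(Q(F))\circ\widetilde\phi=Q(\Phi(F)\circ\phi)$. Functions ${\bf\Phi}^n_{X,Y}:D_p^n(X,Y)\to D_{p'}^n(\Phi(X),\Phi(Y))$ are given by ${\bf\Phi}^0(f)=\Phi(f)$ and ${\bf\Phi}^n_{X,Y}((F,a))=(\Phi(F)\circ\phi,\iota_{\bf\Phi}^{X,F}\circ{\bf\Phi}^{n-1}_{(X;F),Y}(a))$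 for $n\ge1$. The homomorphism $H:CC(\mathcal C,p)\to CC(\mathcal C',p')$ and the isomorphisms $\psi(\Gamma):int(H(\Gamma))\to\Phi(int(\Gamma))$: on objects $H(n,A)=(n,H_n(A))$ and $\psi(n,A)=\psi_n(A)$, where $H_0(tt)=tt$, $\psi_0(tt):pt'\to\Phi(pt)$ is the unique morphism, $H_{n+1}(A,F)=(H_n(A),\psi_n(A)\circ\Phi(F)\circ\phi)$, and $\psi_{n+1}(A,F)$ is the unique morphism $int(H_{n+1}(A,F))\to\Phi(int(A,F))$ with $\psi_{n+1}(A,F)\circ\Phi(Q(F))\circ\widetilde\phi=Q(\psi_n(A)\circ\Phi(F)\circ\phi)$ and $\psi_{n+1}(A,F)\circ\Phi(p_F)=p_{\psi_n(A)\circ\Phi(F)\circ\phi}\circ\psi_n(A)$. On morphisms $f:\Gamma'\to\Gamma$, $H(f):H(\Gamma')\to H(\Gamma)$ is the unique morphism with $int(H(f))=\psi(\Gamma')\circ\Phi(int(f))\circ\psi(\Gamma)^{-1}$. *)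

(* Defs.v *)
From Stdlib Require Import IndefiniteDescription Lia.

Set Implicit Arguments.
Unset Strict Implicit.
Unset Printing Implicit Defensive.

(* Composition is diagrammatic: [f >> g] is "first f, then g". *)
Reserved Notation "f >> g" (at level 45, right associativity).

Record category := Category {
  ob :> Type;
  hom : ob -> ob -> Type;
  idm : forall X, hom X X;
  comp : forall X Y Z, hom X Y -> hom Y Z -> hom X Z;
  comp1m : forall X Y (f : hom X Y), comp (idm X) f = f;
  compm1 : forall X Y (f : hom X Y), comp f (idm Y) = f;
  compA : forall X Y Z W (f : hom X Y) (g : hom Y Z) (h : hom Z W),
    comp f (comp g h) = comp (comp f g) h
}.
Arguments hom {c} X Y.
Arguments idm {c} X.
Arguments comp {c X Y Z} f g.
Notation "f >> g" := (comp f g).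

Record functor (C D : category) := Functor {
  fob :> C -> D;
  fmor : forall X Y : C, hom X Y -> hom (fob X) (fob Y);
  fmor_id : forall X : C, fmor (idm X) = idm (fob X);
  fmor_comp : forall (X Y Z : C) (f : hom X Y) (g : hom Y Z),
    fmor (f >> g) = fmor f >> fmor g
}.
Arguments fmor {C D} _ {X Y} _.

Definition hom_cast (C : category) (X X' Y Y' : C) (eX : X = X') (eY : Y = Y')
    (f : hom X Y) : hom X' Y' :=
  eq_rect Y (fun Z => hom X' Z) (eq_rect X (fun Z => hom Z Y) f X' eX) Y' eY.

Definition is_inverse (C : category) (X Y : C) (f : hom X Y) (g : hom Y X) :=
  f >> g = idm X /\ g >> f = idm Y.

Definition is_iso (C : category) (X Y : C) (f : hom X Y) :=
  exists g, is_inverse f g.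

Lemma is_inverse_unique (C : category) (X Y : C) (f : hom X Y) :
  is_iso f -> exists! g, is_inverse f g.
Proof.
intros [g [fg gf]]; exists g; split; [now split|].
intros g' [fg' gf'].
now rewrite <- (comp1m g'), <- gf, <- compA, fg', compm1.
Qed.

Definition inverse (C : category) (X Y : C) (f : hom X Y) (i : is_iso f) :
    hom Y X :=
  proj1_sig (constructive_definite_description _ (is_inverse_unique i)).

Lemma inverseP (C : category) (X Y : C) (f : hom X Y) (i : is_iso f) :
  is_inverse f (inverse i).
Proof.
exact (proj2_sig (constructive_definite_description _ (is_inverse_unique i))).
Qed.

Definition is_final (C : category) (Z : C) :=
  forall X : C, exists! f : hom X Z, True.

Definition to_final (C : category) (Z : C) (i : is_final Z) (X : C) : hom X Z :=
  proj1_sig (constructive_definite_description _ (i X)).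

Lemma final_unique (C : category) (Z : C) (i : is_final Z) (X : C)
  (f g : hom X Z) : f = g.
Proof. now destruct (i X) as [h [_ hu]]; rewrite <- (hu f I), <- (hu g I). Qed.

(*   W --a--> Y
     |        |
     b        q
     v        v
     X --f--> Z   *)
Definition is_pullback (C : category) (W X Y Z : C) (a : hom W Y) (b : hom W X)
    (q : hom Y Z) (f : hom X Z) :=
  a >> q = b >> f /\
  forall (V : C) (y : hom V Y) (x : hom V X), y >> q = x >> f ->
    exists! h : hom V W, h >> a = y /\ h >> b = x.

Definition pb_lift (C : category) (W X Y Z : C) (a : hom W Y) (b : hom W X)
    (q : hom Y Z) (f : hom X Z) (P : is_pullback a b q f) (V : C)
    (y : hom V Y) (x : hom V X) (e : y >> q = x >> f) : hom V W :=
  proj1_sig (constructive_definite_description _ (proj2 P V y x e)).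

Section PullbackFacts.
Variables (C : category) (W X Y Z : C) (a : hom W Y) (b : hom W X).
Variables (q : hom Y Z) (f : hom X Z) (P : is_pullback a b q f).

Lemma pb_lift_a (V : C) (y : hom V Y) (x : hom V X) (e : y >> q = x >> f) :
  pb_lift P e >> a = y.
Proof.
exact (proj1 (proj2_sig
  (constructive_definite_description _ (proj2 P V y x e)))).
Qed.

Lemma pb_lift_b (V : C) (y : hom V Y) (x : hom V X) (e : y >> q = x >> f) :
  pb_lift P e >> b = x.
Proof.
exact (proj2 (proj2_sig
  (constructive_definite_description _ (proj2 P V y x e)))).
Qed.

Lemma pb_ext (V : C) (h k : hom V W) :
  h >> a = k >> a -> h >> b = k >> b -> h = k.
Proof.
intros ea eb.
assert (e : (k >> a) >> q = (k >> b) >> f).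
  now rewrite <- !compA, (proj1 P).
destruct (proj2 P V _ _ e) as [m [_ mu]].
now rewrite <- (mu h (conj ea eb)), <- (mu k (conj eq_refl eq_refl)).
Qed.

Lemma pb_paste (Y2 Z2 : C) (c : hom Y Y2) (q2 : hom Y2 Z2) (g : hom Z Z2) :
  is_pullback c q q2 g -> is_pullback (a >> c) b q2 (f >> g).
Proof.
intros P2; split.
  now rewrite <- compA, (proj1 P2), compA, (proj1 P), <- compA.
intros V y x e.
assert (e2 : y >> q2 = (x >> f) >> g) by now rewrite e, compA.
destruct (proj2 P2 V _ _ e2) as [m [[mc mq] mu]].
destruct (proj2 P V _ _ mq) as [h [[ha hb] hu]].
exists h; split.
  now split; [rewrite compA, ha|].
intros h' [h'ac h'b]; apply hu; split; [symmetry|assumption].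
apply mu; split; [now rewrite <- compA|].
now rewrite <- compA, (proj1 P), compA, h'b.
Qed.

End PullbackFacts.

Record univ_cat := UnivCat {
  ucat :> category;
  U : ucat;
  Ut : ucat;
  p : hom Ut U;
  ext : forall X : ucat, hom X U -> ucat;
  pr : forall (X : ucat) (F : hom X U), hom (ext F) X;
  Q : forall (X : ucat) (F : hom X U), hom (ext F) Ut;
  ext_pb : forall (X : ucat) (F : hom X U), is_pullback (Q F) (pr F) p F;
  pt : ucat;
  pt_final : is_final pt
}.
Arguments U {u}.
Arguments Ut {u}.
Arguments p {u}.
Arguments ext {u} X F.
Arguments pr {u X} F.
Arguments Q {u X} F.
Arguments ext_pb {u X} F.
Arguments pt u : clear implicits.
Arguments pt_final u : clear implicits.

Section UniverseConstructions.
Variable C : univ_cat.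

Lemma Qm_comm (X' X : C) (f : hom X' X) (F : hom X U) :
  Q (f >> F) >> p = (pr (f >> F) >> f) >> F.
Proof. now rewrite <- compA; apply (proj1 (ext_pb (f >> F))). Qed.

(* The morphism Q(f, F). *)
Definition Qm (X' X : C) (f : hom X' X) (F : hom X U) :
    hom (ext X' (f >> F)) (ext X F) :=
  pb_lift (ext_pb F) (Qm_comm f F).

Fixpoint D (n : nat) (X Y : C) : Type :=
  match n with
  | 0 => hom X Y
  | S m => {F : hom X U & D m (ext X F) Y}
  end.

(* [Dpre f d] is f o d and [Dpost g d] is d o g (diagrammatic order). *)
Fixpoint Dpre (n : nat) (X' X Y : C) (f : hom X' X) : D n X Y -> D n X' Y :=
  match n return D n X Y -> D n X' Y with
  | 0 => fun d => f >> d
  | S m => fun d =>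
      existT (fun F => D m (ext X' F) Y) (f >> projT1 d)
             (Dpre (Qm f (projT1 d)) (projT2 d))
  end.

Fixpoint Dpost (n : nat) (X Y Y' : C) (g : hom Y Y') : D n X Y -> D n X Y' :=
  match n return D n X Y -> D n X Y' with
  | 0 => fun d => d >> g
  | S m => fun d =>
      existT (fun F => D m (ext X F) Y') (projT1 d) (Dpost g (projT2 d))
  end.

Definition D_cast (n : nat) (X X' Y : C) (e : X = X') (d : D n X Y) :
    D n X' Y :=
  eq_rect X (fun Z => D n Z Y) d X' e.

(* The sets Ob_n together with int : Ob_n -> Ob(C), by simultaneous
   recursion. *)
Fixpoint ObInt (n : nat) : {A : Type & A -> ob C} :=
  match n with
  | 0 => existT (fun A : Type => A -> ob C) unit (fun _ => pt C)
  | S m =>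
      existT (fun A : Type => A -> ob C)
        {A : projT1 (ObInt m) & hom (projT2 (ObInt m) A) U}
        (fun AF => ext (projT2 (ObInt m) (projT1 AF)) (projT2 AF))
  end.

Definition Ob (n : nat) : Type := projT1 (ObInt n).
Definition int_ob (n : nat) (A : Ob n) : C := projT2 (ObInt n) A.

(* [(A, F)] as an element of Ob_{n+1}. *)
Definition ob_ext (n : nat) (A : Ob n) (F : hom (int_ob A) U) : Ob (S n) :=
  existT (fun A : Ob n => hom (int_ob A) U) A F.

Definition CC : category := {|
  ob := {n : nat & Ob n};
  hom := fun G' G => hom (int_ob (projT2 G')) (int_ob (projT2 G));
  idm := fun G => idm (int_ob (projT2 G));
  comp := fun G2 G1 G0 f g => f >> g;
  comp1m := fun G1 G0 f => comp1m f;
  compm1 := fun G1 G0 f => compm1 f;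
  compA := fun G3 G2 G1 G0 f g h => compA f g h
|}.

Definition int : functor CC C := {|
  fob := fun G : CC => int_ob (projT2 G);
  fmor := fun (G' G : CC) (f : hom G' G) => f;
  fmor_id := fun G => eq_refl;
  fmor_comp := fun G2 G1 G0 f g => eq_refl
|}.

Definition len (G : CC) : nat := projT1 G.

Definition ft (G : CC) : CC :=
  match G with
  | existT _ 0 A => existT Ob 0 A
  | existT _ (S n) AF => existT Ob n (projT1 AF)
  end.

Definition ftn (n : nat) (T : CC) : CC := Nat.iter n ft T.

(* In length 0, where ft is the identity, p_T is taken to be the identity, as
   usual for C-systems; codomains of elements of \widetilde{Ob}_n(G) with n >= 1
   have positive length. *)
Definition prT (T : CC) : hom T (ft T) :=
  match T return @hom CC T (ft T) with
  | existT _ 0 A => idm (existT Ob 0 A : CC)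
  | existT _ (S n) AF =>
      pr (projT2 AF : hom (int_ob (projT1 AF : Ob n)) U)
  end.

Definition sec (D0 : category) (Y X : D0) (q : hom Y X) : Type :=
  {s : hom X Y | s >> q = idm X}.

Definition ObG (n : nat) (G : CC) : Type :=
  {T : CC | len T = len G + n /\ ftn n T = G}.

Definition obT (n : nat) (G : CC) (T : ObG n G) : CC := proj1_sig T.

(* A morphism o lying in sec(p_T) with T := codom o has domain ft T, so it is
   given by T and the section. *)
Definition ObtG (n : nat) (G : CC) : Type :=
  {T : ObG n G & sec (prT (obT T))}.

Definition bd (n : nat) (G : CC) (o : ObtG n G) : ObG n G := projT1 o.
Definition mor (n : nat) (G : CC) (o : ObtG n G) :
    hom (ft (obT (bd o))) (obT (bd o)) :=
  proj1_sig (projT2 o).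

Lemma len_ft (T : CC) : len (ft T) = pred (len T).
Proof. now destruct T as [[|n] A]. Qed.

Lemma len_ftn (n : nat) (T : CC) : len (ftn n T) = len T - n.
Proof.
induction n as [|n IH]; [cbn; lia|].
change (ftn (S n) T) with (ft (ftn n T)); rewrite len_ft, IH; lia.
Qed.

Section Tower.
Variables (m : nat) (G : CC) (T : ObG (S m) G).

Lemma anc_subproof :
  len (ftn m (obT T)) = len G + 1 /\
  ftn 1 (ftn m (obT T)) = G.
Proof.
destruct (proj2_sig T) as [lT fT]; split; [|exact fT].
rewrite len_ftn; unfold obT; lia.
Qed.

(* ft^m(T), as an element of Ob_1(G). *)
Definition anc : ObG 1 G := exist _ (ftn m (obT T)) anc_subproof.

Lemma over_anc_subproof :
  len (obT T) = len (obT anc) + m /\ ftn m (obT T) = obT anc.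
Proof.
destruct (proj2_sig T) as [lT fT]; split; [|reflexivity].
cbn [anc obT proj1_sig]; rewrite len_ftn; unfold obT; lia.
Qed.

(* T, as an element of Ob_m(ft^m(T)). *)
Definition over_anc : ObG m (obT anc) := exist _ (obT T) over_anc_subproof.

End Tower.

(* [last_mor T] is F for T = (n+1, (A, F)). *)
Definition last_mor (T : CC) : 0 < len T -> hom (int (ft T)) U :=
  match T return 0 < len T -> hom (int (ft T)) U with
  | existT _ 0 A => fun h => False_rect _ (PeanoNat.Nat.lt_irrefl 0 h)
  | existT _ (S n) AF => fun _ => projT2 AF
  end.

Lemma ObG1_len (G : CC) (T : ObG 1 G) : 0 < len (obT T).
Proof. destruct (proj2_sig T) as [lT _]; unfold obT; lia. Qed.

Lemma ObG1_ft (G : CC) (T : ObG 1 G) : ft (obT T) = G.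
Proof. exact (proj2 (proj2_sig T)). Qed.

Definition u1 (G : CC) (T : ObG 1 G) : hom (int G) U :=
  hom_cast (f_equal int (ObG1_ft T)) eq_refl (last_mor (ObG1_len T)).

Lemma int_ObG1 (G : CC) (T : ObG 1 G) : int (obT T) = ext (int G) (u1 T).
Proof.
unfold u1; generalize (ObG1_len T) (ObG1_ft T).
destruct T as [[[|n] AF] lf]; cbn; intros l e; [lia|].
now destruct e.
Qed.

Definition ut1 (G : CC) (o : ObtG 1 G) : hom (int G) Ut :=
  hom_cast (f_equal int (ObG1_ft (bd o))) (int_ObG1 (bd o))
    (fmor int (mor o)) >> Q (u1 (bd o)).

(* [u m] is the function u_{m+1}. *)
Fixpoint u (m : nat) (G : CC) : ObG (S m) G -> D m (int G) U :=
  match m return ObG (S m) G -> D m (int G) U with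
  | 0 => fun T => u1 T
  | S k => fun T =>
      existT (fun F => D k (ext (int G) F) U) (u1 (anc T))
        (D_cast (int_ObG1 (anc T)) (u (over_anc T)))
  end.

(* o, as an element of \widetilde{Ob}_m(ft^m(bd o)). *)
Definition overt_anc (m : nat) (G : CC) (o : ObtG (S m) G) :
    ObtG m (obT (anc (bd o))) :=
  existT (fun T : ObG m (obT (anc (bd o))) => sec (prT (obT T)))
    (over_anc (bd o)) (projT2 o).

(* [ut m] is the function \widetilde u_{m+1}. *)
Fixpoint ut (m : nat) (G : CC) : ObtG (S m) G -> D m (int G) Ut :=
  match m return ObtG (S m) G -> D m (int G) Ut with
  | 0 => fun o => ut1 o
  | S k => fun o =>
      existT (fun F => D k (ext (int G) F) Ut) (u1 (anc (bd o)))
        (D_cast (int_ObG1 (anc (bd o))) (ut (overt_anc o)))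
  end.

End UniverseConstructions.

Arguments CC C : clear implicits.
Arguments int {C}.
Arguments D {C} n X Y.

Record univ_functor (C C' : univ_cat) := UnivFunctor {
  ufun :> functor C C';
  phi : hom (ufun U) (U : C');
  phit : hom (ufun Ut) (Ut : C');
  ufun_final : is_final (ufun (pt C));
  ufun_pb : forall (X : C) (F : hom X U),
    is_pullback (fmor ufun (Q F)) (fmor ufun (pr F)) (fmor ufun p)
      (fmor ufun F);
  phi_pb : is_pullback phit (fmor ufun p) p phi
}.

Section UniverseFunctor.
Variables (C C' : univ_cat) (Phi : univ_functor C C').

Definition phi_of (X : C) (F : hom X U) : hom (Phi X) (U : C') :=
  fmor Phi F >> phi Phi.

Lemma Phi_ext_pb (X : C) (F : hom X U) :
  is_pullback (fmor Phi (Q F) >> phit Phi) (fmor Phi (pr F)) p (phi_of F).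
Proof. exact (pb_paste (ufun_pb Phi F) (phi_pb Phi)). Qed.

Definition iota (X : C) (F : hom X U) :
    hom (ext (Phi X) (phi_of F)) (Phi (ext X F)) :=
  pb_lift (Phi_ext_pb F) (proj1 (ext_pb (phi_of F))).

(* The functions Phi^n_{X,Y}. *)
Fixpoint PhiD (n : nat) (X Y : C) : D n X Y -> D n (Phi X) (Phi Y) :=
  match n return D n X Y -> D n (Phi X) (Phi Y) with
  | 0 => fun f => fmor Phi f
  | S m => fun d =>
      existT (fun F => D m (ext (Phi X) F) (Phi Y)) (phi_of (projT1 d))
        (Dpre (iota (projT1 d)) (PhiD (projT2 d)))
  end.

Lemma psi_comm (X : C) (X' : C') (s : hom X' (Phi X)) (F : hom X U) :
  Q (s >> phi_of F) >> p = (pr (s >> phi_of F) >> s) >> phi_of F.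
Proof. exact (Qm_comm s (phi_of F)). Qed.

(* The step from psi_n(A) = s to psi_{n+1}(A, F). *)
Definition psi_step (X : C) (X' : C') (s : hom X' (Phi X)) (F : hom X U) :
    hom (ext X' (s >> phi_of F)) (Phi (ext X F)) :=
  pb_lift (Phi_ext_pb F) (psi_comm s F).

(* H_n(A) together with psi_n(A), by simultaneous recursion. *)
Fixpoint Hpsi (n : nat) :
    forall A : Ob C n, {A' : Ob C' n & hom (int_ob A') (Phi (int_ob A))} :=
  match n return
    forall A : Ob C n, {A' : Ob C' n & hom (int_ob A') (Phi (int_ob A))} with
  | 0 => fun A =>
      existT (fun A' : Ob C' 0 => hom (int_ob A') (Phi (int_ob A)))
        tt (to_final (ufun_final Phi) (pt C'))
  | S m => fun AF =>
      existT (fun A' : Ob C' (S m) => hom (int_ob A') (Phi (int_ob AF)))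
        (ob_ext (projT2 (Hpsi (projT1 AF)) >> phi_of (projT2 AF)))
        (psi_step (projT2 (Hpsi (projT1 AF))) (projT2 AF))
  end.

Definition Hob (G : CC C) : CC C' :=
  existT (Ob C') (projT1 G) (projT1 (Hpsi (projT2 G))).

Definition psi (G : CC C) : hom (int (Hob G)) (Phi (int G)) :=
  projT2 (Hpsi (projT2 G)).

Lemma psi_step_iso (X : C) (X' : C') (s : hom X' (Phi X)) (F : hom X U) :
  is_iso s -> is_iso (psi_step s F).
Proof.
intros [t [st ts]].
assert (e : (fmor Phi (Q F) >> phit Phi) >> p
            = (fmor Phi (pr F) >> t) >> (s >> phi_of F)).
  rewrite <- (compA (fmor Phi (pr F)) t), (compA t s), ts, comp1m.
  exact (proj1 (Phi_ext_pb F)).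
exists (pb_lift (ext_pb (s >> phi_of F)) e); split.
- apply (pb_ext (ext_pb (s >> phi_of F))); rewrite <- compA, comp1m.
  + rewrite pb_lift_a; exact (pb_lift_a (Phi_ext_pb F) (psi_comm s F)).
  + rewrite pb_lift_b, compA.
    unfold psi_step; rewrite (pb_lift_b (Phi_ext_pb F) (psi_comm s F)).
    now rewrite <- compA, st, compm1.
- apply (pb_ext (Phi_ext_pb F)); rewrite <- compA, comp1m.
  + unfold psi_step; rewrite (pb_lift_a (Phi_ext_pb F) (psi_comm s F)).
    exact (pb_lift_a (ext_pb (s >> phi_of F)) e).
  + unfold psi_step; rewrite (pb_lift_b (Phi_ext_pb F) (psi_comm s F)).
    now rewrite compA, pb_lift_b, <- compA, ts, compm1.
Qed.

Lemma psi_iso (G : CC C) : is_iso (psi G).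
Proof.
destruct G as [n A]; unfold psi; cbn; induction n as [|n IH].
- exists (to_final (pt_final C') (Phi (pt C))).
  split; [apply (final_unique (pt_final C'))|].
  apply (final_unique (ufun_final Phi)).
- exact (psi_step_iso (projT2 A) (IH (projT1 A))).
Qed.

Definition Hmor (G' G : CC C) (f : hom G' G) : hom (Hob G') (Hob G) :=
  psi G' >> fmor Phi (fmor int f) >> inverse (psi_iso G).

Lemma Hmor_id (G : CC C) : Hmor (idm G) = idm (Hob G).
Proof.
unfold Hmor; rewrite !fmor_id, comp1m.
exact (proj1 (inverseP (psi_iso G))).
Qed.

Lemma Hmor_comp (G2 G1 G0 : CC C) (f : hom G2 G1) (g : hom G1 G0) :
  Hmor (f >> g) = Hmor f >> Hmor g.
Proof.
change (psi G2 >> fmor Phi (fmor int (f >> g)) >> inverse (psi_iso G0)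
  = (psi G2 >> fmor Phi (fmor int f) >> inverse (psi_iso G1))
    >> (psi G1 >> fmor Phi (fmor int g) >> inverse (psi_iso G0))).
rewrite !fmor_comp, <- !compA; do 2 f_equal.
now rewrite (compA (inverse _)), (proj2 (inverseP (psi_iso G1))), comp1m.
Qed.

Definition HCC : functor (CC C) (CC C') := {|
  fob := Hob; fmor := Hmor; fmor_id := Hmor_id; fmor_comp := Hmor_comp
|}.

Lemma H_ft (T : CC C) : HCC (ft T) = ft (HCC T).
Proof. destruct T as [[|n] A]; [destruct A|]; exact eq_refl. Defined.

Lemma H_ftn (n : nat) (T : CC C) : HCC (ftn n T) = ftn n (HCC T).
Proof.
induction n as [|n IH]; [reflexivity|].
change (HCC (ft (ftn n T)) = ft (ftn n (HCC T))).
now rewrite <- IH, <- H_ft.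
Qed.

Lemma HObG_subproof (n : nat) (G : CC C) (T : ObG n G) :
  len (HCC (obT T)) = len (HCC G) + n /\ ftn n (HCC (obT T)) = HCC G.
Proof.
destruct T as [T [lT fT]]; cbn [obT proj1_sig]; split; [exact lT|].
now rewrite <- H_ftn, fT.
Qed.

Definition HObG (n : nat) (G : CC C) (T : ObG n G) : ObG n (HCC G) :=
  exist _ (HCC (obT T)) (HObG_subproof T).

Lemma psi_step_pr (X : C) (X' : C') (s : hom X' (Phi X)) (F : hom X U)
  (t : hom (Phi X) X') :
  s >> t = idm X' -> psi_step s F >> fmor Phi (pr F) >> t = pr (s >> phi_of F).
Proof.
intros st; rewrite compA; unfold psi_step.
now rewrite (pb_lift_b (Phi_ext_pb F) (psi_comm s F)), <- compA, st, compm1.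
Qed.

Lemma H_pr (T : CC C) :
  hom_cast eq_refl (H_ft T) (fmor HCC (prT T)) = prT (HCC T).
Proof.
destruct T as [[|n] AF].
- destruct AF; exact (fmor_id HCC (existT (Ob C) 0 tt)).
- destruct AF as [A F].
  change (Hmor (prT (existT (Ob C) (S n) (ob_ext F)))
    = pr (psi (existT (Ob C) n A) >> phi_of F)).
  exact (psi_step_pr F (proj1 (inverseP (psi_iso (existT (Ob C) n A))))).
Qed.

Lemma sec_cast (D0 : category) (Y X X' : D0) (e : X = X') (q : hom Y X)
  (s : hom X Y) :
  s >> q = idm X -> hom_cast e eq_refl s >> hom_cast eq_refl e q = idm X'.
Proof. now destruct e. Qed.

Lemma H_sec (T : CC C) (s : sec (prT T)) :
  hom_cast (H_ft T) eq_refl (fmor HCC (proj1_sig s)) >> prT (HCC T)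
  = idm (ft (HCC T)).
Proof.
rewrite <- H_pr; apply sec_cast.
now rewrite <- fmor_comp, (proj2_sig s), fmor_id.
Qed.

(* H(o), whose domain H(ft T) is identified with ft(H(T)). *)
Definition HObtG (n : nat) (G : CC C) (o : ObtG n G) : ObtG n (HCC G) :=
  existT (fun T : ObG n (HCC G) => sec (prT (obT T))) (HObG (bd o))
    (exist _ (hom_cast (H_ft (obT (bd o))) eq_refl (fmor HCC (mor o)))
       (H_sec (projT2 o))).

End UniverseFunctor.

(* Main.v *)
From Stdlib Require Import ProofIrrelevance.
Require Import Defs.

(** Both identities come by induction on n from one compatibility of the pairing
(F, a) in D^{n+1} with the functor.  An object T of length l(G) + n + 1 over G is
the same as its ancestor T1 = ft^n(T) of length l(G) + 1 together with T seen over
T1, and u (and likewise the section version ut) sends T to the pair of F = u_1(T1)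
and the value of u at T over T1.  Applying H replaces F by psi(G) o Phi(F) o phi and,
by the induction hypothesis, the second component a by psi(T1) o Phi(a) o phi.  On
the other side the definitions give the second component
Q(psi(G), Phi(F) o phi) o (iota o Phi(a) o phi).  The two agree because
psi(T1) = Q(psi(G), Phi(F) o phi) o iota, both being the map into the pullback
Phi((X; F)) with the same two projections ([Qm_iota]), and because the action of
morphisms on D^n by precomposition is functorial ([Dpre_comp]) and commutes with
postcomposition ([Dpre_Dpost]).  This is [H_Dpair], stated for an arbitrary target
so that it serves both parts.  The base case of the first part is the definition of
H on objects; that of the second part is the equation
psi(T) o Phi(Q(F)) o phit = Q(psi(G) o Phi(F) o phi) defining psi(T).

What remains is bookkeeping about equalities between objects: an element of Ob_n(G)
carries a proof that ft^n(T) = G, and values are transported along it.  Uniqueness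
of equality proofs makes these transports trivial as soon as G is of the form ft(T)
([u1_ext], [Dpair_ext]).  Since H commutes with ft, the objects ft^n(H(T)) and
H(ft^n(T)) are equal, and proof irrelevance makes them equal as elements of
Ob_1(H(G)) ([ObG_eq]). *)

Set Implicit Arguments.
Unset Strict Implicit.

(** * Transport along loops *)

Lemma hom_cast_loop (C : category) (X Y : C) (eX : X = X) (eY : Y = Y)
    (f : hom X Y) :
  hom_cast eX eY f = f.
Proof. now rewrite (UIP_refl _ _ eX), (UIP_refl _ _ eY). Qed.

Lemma D_cast_loop (C : univ_cat) (n : nat) (X Y : C) (e : X = X) (d : D n X Y) :
  D_cast e d = d.
Proof. now rewrite (UIP_refl _ _ e). Qed.

Lemma ObG_eq (C : univ_cat) (n : nat) (G : CC C) (T T' : ObG n G) :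
  obT T = obT T' -> T = T'.
Proof.
destruct T as [T h], T' as [T' h']; cbn; intros e; destruct e.
now rewrite (proof_irrelevance _ h h').
Qed.

(** * The action of morphisms on D^n *)

Section Action.
Variable C : univ_cat.

Lemma Qm_Q (X' X : C) (f : hom X' X) (F : hom X U) : Qm f F >> Q F = Q (f >> F).
Proof. exact (pb_lift_a (ext_pb F) (Qm_comm f F)). Qed.

Lemma Qm_pr (X' X : C) (f : hom X' X) (F : hom X U) :
  Qm f F >> pr F = pr (f >> F) >> f.
Proof. exact (pb_lift_b (ext_pb F) (Qm_comm f F)). Qed.

(** The two properties that characterize Q(f, F) determine the second component of
f o (F, a).  Allowing a first component F' that is only propositionally equal to
f o F absorbs the associativity of composition, which would otherwise call for a
transport. *)
Lemma Dpre_pair (n : nat) (X' X Y : C) (f : hom X' X) (F : hom X U)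
    (a : D n (ext X F) Y) (F' : hom X' U) (h : hom (ext X' F') (ext X F)) :
  F' = f >> F -> h >> Q F = Q F' -> h >> pr F = pr F' >> f ->
  existT (fun F => D n (ext X' F) Y) F' (Dpre h a)
  = existT (fun F => D n (ext X' F) Y) (f >> F) (Dpre (Qm f F) a).
Proof.
intros e; subst F'; intros hQ hpr.
replace h with (Qm f F); [reflexivity|].
apply (pb_ext (ext_pb F)); [now rewrite hQ, Qm_Q|now rewrite hpr, Qm_pr].
Qed.

Lemma Dpre_comp (n : nat) (X2 X1 X Y : C) (f : hom X2 X1) (g : hom X1 X)
    (d : D n X Y) :
  Dpre f (Dpre g d) = Dpre (f >> g) d.
Proof.
revert X2 X1 X f g d; induction n as [|n IH]; intros X2 X1 X f g d.
- exact (compA f g d).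
- destruct d as [F a]; cbn; rewrite IH; apply Dpre_pair.
  + apply compA.
  + now rewrite <- compA, !Qm_Q.
  + rewrite <- compA, Qm_pr, (compA (Qm f _)), Qm_pr.
    symmetry; apply compA.
Qed.

Lemma Dpre_Dpost (n : nat) (X' X Y Y' : C) (f : hom X' X) (g : hom Y Y')
    (d : D n X Y) :
  Dpre f (Dpost g d) = Dpost g (Dpre f d).
Proof.
revert X' X f d; induction n as [|n IH]; intros X' X f d; cbn.
- apply compA.
- now rewrite IH.
Qed.

End Action.

(** * Objects of length one over a given object *)

Section OneStep.
Variable C : univ_cat.

(** Eliminates the equation ft(T) = G once and for all, by replacing G with ft(T). *)
Lemma ObG1_rect (P : forall G : CC C, ObG 1 G -> Prop) :
  (forall (n : nat) (A : Ob C n) (F : hom (int_ob A) U) h,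
     P (existT (Ob C) n A) (exist _ (existT (Ob C) (S n) (ob_ext F)) h)) ->
  forall (G : CC C) (T : ObG 1 G), P G T.
Proof.
intros H G [[[|n] AF] [l e]].
- exfalso; cbn in l; rewrite PeanoNat.Nat.add_1_r in l; discriminate l.
- destruct AF as [A F].
  cbn in e; destruct e; exact (H n A F _).
Qed.

Lemma u1_ext (n : nat) (A : Ob C n) (F : hom (int_ob A) U) h :
  @u1 C (existT (Ob C) n A) (exist _ (existT (Ob C) (S n) (ob_ext F)) h) = F.
Proof. exact (hom_cast_loop _ _ F). Qed.

Lemma ut1_ext (n : nat) (A : Ob C n) (F : hom (int_ob A) U) h
    (s : sec (prT (existT (Ob C) (S n) (ob_ext F)))) :
  @ut1 C (existT (Ob C) n A)
    (existT (fun T : ObG 1 (existT (Ob C) n A) => sec (prT (obT T)))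
      (exist _ (existT (Ob C) (S n) (ob_ext F)) h) s)
  = (proj1_sig s : hom (int_ob A) (ext (int_ob A) F)) >> Q F.
Proof.
unfold ut1, bd; cbn [projT1].
generalize (int_ObG1 (exist _ (existT (Ob C) (S n) (ob_ext F)) h
  : ObG 1 (existT (Ob C) n A))).
rewrite u1_ext; intros e.
exact (f_equal (fun f : hom _ (ext (int_ob A) F) => f >> Q F)
  (hom_cast_loop _ e (proj1_sig s))).
Qed.

(** The recursive clause of u and ut, with the target Y left free so that both are
instances. *)
Definition Dpair (k : nat) (Y : C) (G : CC C) (T : ObG 1 G)
    (d : D k (int (obT T)) Y) : D (S k) (int G) Y :=
  existT (fun F => D k (ext (int G) F) Y) (u1 T) (D_cast (int_ObG1 T) d).

Lemma Dpair_ext (k : nat) (Y : C) (n : nat) (A : Ob C n)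
    (F : hom (int_ob A) U) h (d : D k (ext (int_ob A) F) Y) :
  @Dpair k Y (existT (Ob C) n A)
    (exist _ (existT (Ob C) (S n) (ob_ext F)) h) d
  = existT (fun F => D k (ext (int_ob A) F) Y) F d.
Proof.
unfold Dpair; generalize (int_ObG1 (exist _ (existT (Ob C) (S n) (ob_ext F)) h
  : ObG 1 (existT (Ob C) n A))).
rewrite u1_ext; intros e; cbn in e |- *.
now rewrite D_cast_loop.
Qed.

Lemma Dpair_u_eq (k : nat) (G : CC C) (T1 T1' : ObG 1 G)
    (T : ObG (S k) (obT T1)) (T' : ObG (S k) (obT T1')) :
  obT T1 = obT T1' -> obT T = obT T' -> Dpair (u T) = Dpair (u T').
Proof.
intros e1 e; apply ObG_eq in e1; destruct e1.
now apply ObG_eq in e; destruct e.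
Qed.

(** The underlying object T0 and its section are shared on the nose, so that no
transport of sections enters the statement. *)
Lemma Dpair_ut_eq (k : nat) (G : CC C) (T1 T1' : ObG 1 G) (T0 : CC C)
    (s : sec (prT T0)) h h' :
  obT T1 = obT T1' ->
  Dpair (ut (existT (fun T : ObG (S k) (obT T1) => sec (prT (obT T)))
    (exist _ T0 h) s))
  = Dpair (ut (existT (fun T : ObG (S k) (obT T1') => sec (prT (obT T)))
    (exist _ T0 h') s)).
Proof.
intros e1; apply ObG_eq in e1; destruct e1.
now rewrite (proof_irrelevance _ h h').
Qed.

End OneStep.

(** * Compatibility with the homomorphism H *)

Section Compatibility.
Variables (C C' : univ_cat) (Phi : univ_functor C C').

(** Both sides are maps into the pullback Phi((X; F)) with the same projections. *)
Lemma Qm_iota (X : C) (X' : C') (s : hom X' (Phi X)) (F : hom X U) :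
  Qm s (phi_of Phi F) >> iota Phi F = psi_step s F.
Proof.
unfold iota, psi_step; apply (pb_ext (Phi_ext_pb Phi F)).
- now rewrite <- compA, !pb_lift_a, Qm_Q.
- now rewrite <- compA, !pb_lift_b, Qm_pr.
Qed.

Lemma H_Dpair (k : nat) (Y : C) (Y' : C') (g : hom (Phi Y) Y') (G : CC C)
    (T : ObG 1 G) (d : D k (int (obT T)) Y) :
  Dpair (T := HObG Phi T) (Dpre (psi Phi (obT T)) (Dpost g (PhiD Phi d)))
  = Dpre (psi Phi G) (Dpost g (PhiD Phi (Dpair d))).
Proof.
revert G T d; refine (ObG1_rect _); intros n A F h d.
rewrite Dpair_ext.
etransitivity; [exact (Dpair_ext _ _)|].
cbn [PhiD Dpost Dpre projT1 projT2].
rewrite <- Dpre_Dpost, Dpre_comp, Qm_iota.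
reflexivity.
Qed.

Lemma H_u1 (G : CC C) (T : ObG 1 G) :
  u1 (HObG Phi T) = psi Phi G >> fmor Phi (u1 T) >> phi Phi.
Proof.
revert G T; refine (ObG1_rect _); intros n A F h.
rewrite u1_ext; exact (u1_ext _).
Qed.

Lemma Hmor_psi (G' G : CC C) (f : hom G' G) :
  fmor int (Hmor Phi f) >> psi Phi G = psi Phi G' >> fmor Phi (fmor int f).
Proof.
change ((psi Phi G' >> fmor Phi (fmor int f) >> inverse (psi_iso Phi G))
  >> psi Phi G = psi Phi G' >> fmor Phi (fmor int f)).
now rewrite <- !compA, (proj2 (inverseP (psi_iso Phi G))), compm1.
Qed.

(** For T = (A, F) and a section s of p_T, write Q(psi(G) o Phi(F) o phi), which
ends the left-hand side, as psi(T) o Phi(Q(F)) o phit by the definition of psi(T),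
and move psi across H(s) by naturality. *)
Lemma H_ut1 (G : CC C) (o : ObtG 1 G) :
  ut1 (HObtG Phi o) = psi Phi G >> fmor Phi (ut1 o) >> phit Phi.
Proof.
destruct o as [T s]; revert G T s; refine (ObG1_rect _); intros n A F h s.
etransitivity; [apply ut1_ext|].
rewrite ut1_ext.
set (T := existT (Ob C) (S n) (ob_ext F) : CC C) in *.
set (G := existT (Ob C) n A : CC C) in *.
assert (defpsi : psi Phi T >> fmor Phi (Q F) >> phit Phi
    = Q (psi Phi G >> phi_of Phi F)).
{ exact (pb_lift_a (Phi_ext_pb Phi F) (psi_comm _ F)). }
rewrite fmor_comp, <- compA, compA.
(* On an object of positive length the identification of H(ft T) with ft(H(T)) is
   reflexivity, so the section of H(T) is H(s) itself. *)
change (fmor int (Hmor Phi (proj1_sig s)) >> Q (psi Phi G >> phi_of Phi F)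
  = (psi Phi G >> fmor Phi (fmor int (proj1_sig s)))
    >> fmor Phi (Q F) >> phit Phi).
rewrite <- defpsi, <- Hmor_psi; apply compA.
Qed.

End Compatibility.

(* [n] is the n - 1 of the usual indexing: the claim about u_{n,Gamma} for
   n >= 1 is stated for u_{n+1,Gamma} with n an arbitrary natural number. *)
Theorem lemma3p17 (C C' : univ_cat) (Phi : univ_functor C C') (G : CC C)
    (n : nat) :
  (forall T : ObG (S n) G,
     u (HObG Phi T) = Dpre (psi Phi G) (Dpost (phi Phi) (PhiD Phi (u T)))) /\
  (forall o : ObtG (S n) G,
     ut (HObtG Phi o) =
       Dpre (psi Phi G) (Dpost (phit Phi) (PhiD Phi (ut o)))).
Proof.
revert G; induction n as [|n IH]; intros G; split.
- exact (@H_u1 C C' Phi G).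
- exact (@H_ut1 C C' Phi G).
- intros T.
  transitivity (Dpair (T := HObG Phi (anc T)) (u (HObG Phi (over_anc T)))).
  + apply Dpair_u_eq; [|reflexivity].
    exact (eq_sym (H_ftn Phi (S n) (obT T))).
  + rewrite (proj1 (IH _)); apply H_Dpair.
- intros o.
  transitivity (Dpair (T := HObG Phi (anc (bd o)))
    (ut (HObtG Phi (overt_anc o)))).
  + apply Dpair_ut_eq.
    exact (eq_sym (H_ftn Phi (S n) (obT (bd o)))).
  + rewrite (proj2 (IH _)); apply H_Dpair.
Qed.
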